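(* Let $a < b$ be real numbers, let $f \in C[a,b]$, and let $\alpha > 0$ with $\alpha \notin \mathbb{N}$. Let $n = \lceil \alpha \rceil$ and $c_\alpha = \frac{\sin \pi\alpha}{\pi} \prod_{\ell=1}^{n-1} \frac{1}{\ell-\alpha}$. Let $\psi : \Omega \to (0,\infty)$ be an admissible transformation, and for $t \in [a,b]$, $\omega \in \Omega$ let $$\phi(t,\omega) = c_\alpha\, \psi'(\omega)\, (\psi(\omega))^{n-\alpha-1} \int_a^t (t-\tau)^{n-1} \exp(-(t-\tau)\psi(\omega))\, f(\tau)\, \mathrm{d}\tau .$$ Then, for any $\omega \in \Omega$, the function $\phi(\cdot,\omega)$ is the unique solution on the interval $[a,b]$ to the $n$-th order differential equation $$\sum_{k=0}^n \binom{n}{k} (\psi(\omega))^{n-k} \frac{\partial^k \phi}{\partial t^k}(t,\omega) = c_\alpha\, \psi'(\omega)\, (\psi(\omega))^{n-1-\alpha}\, (n-1)! \cdot f(t)$$ subject to the initial conditions $$\frac{\partial^k \phi}{\partial t^k}(a,\omega) = 0 \qquad (k = 0,1,\ldots,n-1).$$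
   Context: A function $\psi : \Omega \to (0,\infty)$ is called an admissible transformation if: (i) its domain $\Omega$ is a non-empty open interval of $\mathbb{R}$ (possibly unbounded); (ii) $\psi \in C^1(\Omega)$; (iii) $\psi$ is strictly monotonically increasing; (iv) $\lim_{\omega \to \inf\Omega} \psi(\omega) = 0$ and $\lim_{\omega \to \sup\Omega} \psi(\omega) = +\infty$. Here $\mathbb{N} = \{1,2,3,\ldots\}$, and an empty product equals $1$. The differential equation is regarded as an ordinary differential equation in the variable $t$, with $\omega$ a fixed parameter; derivatives at the endpoints of $[a,b]$ are one-sided. *)

(* Defs.v *)
(* Stdlib real numbers with Coquelicot. *)
From Stdlib Require Import Reals ZArith List.
From Coquelicot Require Import Coquelicot.
Open Scope R_scope.

Definition itv_cc (a b : R) : R -> Prop := fun t => a <= t <= b.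

(* The domain is a set Omega, and psi is a total function on R of which only
   the restriction to Omega matters.  inf Omega and sup Omega are extended
   reals, so that unbounded intervals are covered; in the limits the variable
   ranges over Omega only. *)
Record admissible (Omega : R -> Prop) (psi : R -> R) : Prop := {
  adm_nonempty : exists w, Omega w;
  adm_open : open Omega;
  adm_interval : forall x y z, Omega x -> Omega z -> x <= y <= z -> Omega y;
  adm_pos : forall w, Omega w -> 0 < psi w;
  adm_derivable : forall w, Omega w -> ex_derive psi w;
  adm_C1 : continuous_on Omega (Derive psi);
  adm_increasing : forall w1 w2, Omega w1 -> Omega w2 -> w1 < w2 ->
    psi w1 < psi w2;
  adm_lim_inf :
    filterlim psi (within Omega (Rbar_locally (Glb_Rbar Omega))) (locally 0);
  adm_lim_sup :
    filterlim psi (within Omega (Rbar_locally (Lub_Rbar Omega)))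
      (Rbar_locally p_infty)
}.

Definition c_coef (n : nat) (alpha : R) : R :=
  sin (PI * alpha) / PI *
  fold_right Rmult 1 (map (fun l => 1 / (INR l - alpha)) (seq 1 (n - 1))).

Definition phi (a : R) (f : R -> R) (n : nat) (alpha : R) (psi : R -> R)
    (t w : R) : R :=
  c_coef n alpha * Derive psi w * Rpower (psi w) (INR n - alpha - 1) *
  RInt (fun tau => (t - tau) ^ (n - 1) * exp (- (t - tau) * psi w) * f tau) a t.

(* [is_derive] with the increments restricted to D: on D = [a, b] this is the
   usual derivative at interior points and the one-sided one at a and b. *)
Definition is_derive_on (D : R -> Prop) (g : R -> R) (t l : R) : Prop :=
  filterdiff g (within D (locally t)) (fun h : R => scal h l).

(* dy k is the k-th derivative of y on [a, b], for all k <= n.  For a < b the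
   values of dy k on [a, b] are determined by y. *)
Definition derivatives_on (a b : R) (n : nat) (y : R -> R)
    (dy : nat -> R -> R) : Prop :=
  (forall t, itv_cc a b t -> dy 0%nat t = y t) /\
  (forall k, (k < n)%nat -> forall t, itv_cc a b t ->
     is_derive_on (itv_cc a b) (dy k) t (dy (S k) t)).

Definition solves_ivp (a b : R) (n : nat) (p : R) (r y : R -> R) : Prop :=
  exists dy : nat -> R -> R,
    derivatives_on a b n y dy /\
    (forall t, itv_cc a b t ->
       sum_f_R0 (fun k => Binomial.C n k * p ^ (n - k) * dy k t) n = r t) /\
    (forall k, (k < n)%nat -> dy k a = 0).

(* Main.v *)
Require Import Defs.
From Stdlib Require Import Reals ZArith List.
From Stdlib Require Import Lra Lia Classical.
From Coquelicot Require Import Coquelicot.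
Open Scope R_scope.

(** Write [p] for [psi w] and [D] for d/dt.  The left-hand side of the equation
    is [(D + p)^n] applied to the unknown function, and [D + p] is [D]
    conjugated by [exp (p t)]: everything reduces to iterated
    differentiation and iterated integration.

    Uniqueness ([solves_ivp_unique]).  Let [e] be the difference of two
    solutions and [T_j = (D + p)^j e].  Then [T_n = 0], every [T_j] with
    [j < n] vanishes at [a], and [(exp (p t) T_j)' = exp (p t) T_(j+1)].  So
    [T_(j+1) = 0] makes [exp (p t) T_j] constant, hence zero, and descending
    from [j = n] to [j = 0] gives [e = 0] ([homogeneous_zero]).

    Existence ([damped_int_solves]).  Let [G_j] be [exp (- p t)] times the
    [j]-fold integral from [a] of [exp (p s) F s].  Then [G_0 = F],
    [G_(j+1)(a) = 0] and [(D + p) G_(j+1) = G_j], so that [G_n] solves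
    [(D + p)^n y = F] with zero initial data.  Cauchy's formula for repeated
    integration ([iter_int_cauchy]) turns [G_n] into the single convolution
    integral that defines [phi], up to constants
    ([damped_int_convolution]).

    Two devices keep this elementary.  One-sided derivatives on [a, b] are
    the same thing as ordinary derivatives of functions that agree with the
    given one on [a, b] ([is_derive_on_extend], [is_derive_on_restrict]), so
    the usual calculus rules carry over.  And [(D + p)^j] is handled through
    the sequence of derivatives of a function at a point, on which [D] acts as
    the shift; there the recursive form of the power and its binomial
    expansion are related by a purely algebraic identity
    ([shift_pow_binomial]). *)

(** * One-sided derivatives on a closed interval *)

Definition clamp (a b x : R) : R := Rmax a (Rmin b x).

Lemma clamp_in a b x : a < b -> itv_cc a b (clamp a b x).
Proof.
  intros hab; unfold itv_cc, clamp, Rmax, Rmin.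
  repeat destruct (Rle_dec _ _); lra.
Qed.

Lemma clamp_id a b x : itv_cc a b x -> clamp a b x = x.
Proof.
  unfold itv_cc, clamp, Rmax, Rmin; intros hx.
  repeat destruct (Rle_dec _ _); lra.
Qed.

Lemma clamp_contracting a b x y :
  a < b -> Rabs (clamp a b x - clamp a b y) <= Rabs (x - y).
Proof.
  intros hab; unfold clamp, Rmax, Rmin.
  repeat destruct (Rle_dec _ _); unfold Rabs;
    repeat destruct (Rcase_abs _); lra.
Qed.

(** Freezing a function at its endpoint values makes it continuous on the whole
    line, where integrals can be differentiated without one-sided limits. *)
Lemma continuous_clamp_ext a b (f : R -> R) :
  a < b -> continuous_on (itv_cc a b) f ->
  forall x, continuous (fun t => f (clamp a b t)) x.
Proof.
  intros hab hf x.
  apply filterlim_comp with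
    (within (itv_cc a b) (locally (clamp a b x))).
  - intros P [d hd].
    exists d; intros y hy.
    apply hd; [|now apply clamp_in].
    change (Rabs (clamp a b y - clamp a b x) < d).
    apply Rle_lt_trans with (Rabs (y - x)); [now apply clamp_contracting|].
    exact hy.
  - apply hf; now apply clamp_in.
Qed.

(** Beyond the endpoints the extension has slope [l] exactly, so the error in
    the linear approximation at [x] is the error of [g] at the clamped point,
    which is no farther from [t] than [x].  The slope depends on the
    base point [t], so a different extension serves each [t]. *)
Lemma is_derive_clamp_ext a b (g : R -> R) (t l : R) :
  a < b -> itv_cc a b t -> is_derive_on (itv_cc a b) g t l ->
  is_derive (fun x => g (clamp a b x) + l * (x - clamp a b x)) t l.
Proof.
  intros hab ht [_ hd].
  split; [apply (is_linear_scal_l (V := R_NormedModule))|].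
  intros x hx.
  apply (is_filter_lim_locally_unique (V := R_NormedModule)) in hx; subst x.
  assert (hlim : is_filter_lim (within (itv_cc a b) (locally t)) t).
  { intros P [d hP]; exists d; intros y hy _; now apply hP. }
  specialize (hd t hlim).
  intros eps; destruct (hd eps) as [d hd'].
  exists d; intros y hy.
  assert (hc : Rabs (clamp a b y - t) <= Rabs (y - t)).
  { rewrite <- (clamp_id a b t ht) at 1; now apply clamp_contracting. }
  assert (hcd : ball t d (clamp a b y)).
  { exact (Rle_lt_trans _ _ _ hc hy). }
  specialize (hd' _ hcd (clamp_in a b y hab)).
  rewrite (clamp_id a b t ht).
  change (Rabs (g (clamp a b y) - g t - (clamp a b y - t) * l)
          <= eps * Rabs (clamp a b y - t)) in hd'.
  change (Rabs (g (clamp a b y) + l * (y - clamp a b y)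
                - (g t + l * (t - t)) - (y - t) * l) <= eps * Rabs (y - t)).
  replace (g (clamp a b y) + l * (y - clamp a b y)
                - (g t + l * (t - t)) - (y - t) * l)
    with (g (clamp a b y) - g t - (clamp a b y - t) * l) by ring.
  apply Rle_trans with (1 := hd').
  apply Rmult_le_compat_l; [apply Rlt_le, cond_pos | exact hc].
Qed.

Lemma is_derive_on_extend a b (g : R -> R) (t l : R) :
  a < b -> itv_cc a b t -> is_derive_on (itv_cc a b) g t l ->
  exists h : R -> R, is_derive h t l /\ (forall x, itv_cc a b x -> h x = g x).
Proof.
  intros hab ht hd.
  exists (fun x => g (clamp a b x) + l * (x - clamp a b x)); split.
  - now apply is_derive_clamp_ext.
  - intros x hx; simpl; rewrite clamp_id by assumption; ring.
Qed.

(** Together with [is_derive_on_extend] this transports the rules of calculus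
    from two-sided to one-sided derivatives. *)
Lemma is_derive_on_restrict (D : R -> Prop) (g h : R -> R) (t l : R) :
  D t -> is_derive h t l -> (forall x, D x -> h x = g x) ->
  is_derive_on D g t l.
Proof.
  intros ht [_ hd] heq; split; [apply (is_linear_scal_l (V := R_NormedModule))|].
  intros x hx.
  assert (x = t).
  { apply NNPP; intros hne.
    assert (hpos : 0 < Rabs (t - x)) by (apply Rabs_pos_lt; lra).
    destruct (hx _ (locally_ball x (mkposreal _ hpos))) as [d hdx].
    exact (Rlt_irrefl _ (hdx t (ball_center t d) ht)). }
  subst x.
  specialize (hd t (fun P hP => hP)).
  intros eps; destruct (hd eps) as [d hd'].
  exists d; intros y hy hDy.
  rewrite <- !heq by assumption; now apply hd'.
Qed.

Lemma is_derive_on_comb a b (g1 g2 : R -> R) (t l1 l2 c : R) :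
  a < b -> itv_cc a b t ->
  is_derive_on (itv_cc a b) g1 t l1 -> is_derive_on (itv_cc a b) g2 t l2 ->
  is_derive_on (itv_cc a b) (fun x => g1 x + c * g2 x) t (l1 + c * l2).
Proof.
  intros hab ht H1 H2.
  destruct (is_derive_on_extend _ _ _ _ _ hab ht H1) as [h1 [d1 e1]].
  destruct (is_derive_on_extend _ _ _ _ _ hab ht H2) as [h2 [d2 e2]].
  apply (is_derive_on_restrict _ _ (fun x => h1 x + c * h2 x)); trivial.
  - apply (is_derive_plus (V := R_NormedModule)); trivial.
    now apply is_derive_scal.
  - intros x hx; now rewrite e1, e2.
Qed.

(** With slope 0 the extension of [is_derive_clamp_ext] is [g] composed with
    [clamp], the same function for every base point: the mean value
    theorem applies to it. *)
Lemma is_derive_on_const a b (g : R -> R) :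
  a < b -> (forall t, itv_cc a b t -> is_derive_on (itv_cc a b) g t 0) ->
  forall t, itv_cc a b t -> g t = g a.
Proof.
  intros hab hg t ht.
  destruct (Req_dec a t) as [->|hat]; [reflexivity|].
  assert (ha : itv_cc a b a) by (unfold itv_cc; lra).
  transitivity (g (clamp a b t)); [now rewrite clamp_id|].
  transitivity (g (clamp a b a)); [|now rewrite clamp_id].
  symmetry.
  apply (eq_is_derive (fun x => g (clamp a b x)) a t);
    [|unfold itv_cc in ht; lra].
  intros s hs.
  assert (hs' : itv_cc a b s) by (unfold itv_cc in *; lra).
  specialize (hg s hs').
  apply (is_derive_ext (fun x => g (clamp a b x) + 0 * (x - clamp a b x)));
    [intros x; simpl; ring|].
  now apply is_derive_clamp_ext.
Qed.

(** * The operator (E + p)^j on sequences *)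

(** Entry [k] of [(E + p)^j u], where [E] is the shift of sequences.  For
    [u k] the [k]-th derivative of [y] at [t], this is the [k]-th
    derivative of [(D + p)^j y] at [t]. *)
Fixpoint shift_pow (p : R) (j : nat) (u : nat -> R) (k : nat) : R :=
  match j with
  | O => u k
  | S j => shift_pow p j u (S k) + p * shift_pow p j u k
  end.

(** Pascal's rule in the form needed for one more factor [E + p]. *)
Lemma sum_pascal (v : nat -> R) j :
  sum_f_R0 (fun i => Binomial.C (S j) i * v i) (S j) =
  sum_f_R0 (fun i => Binomial.C j i * (v i + v (S i))) j.
Proof.
  destruct j as [|j].
  { simpl; unfold Binomial.C; simpl; field. }
  rewrite decomp_sum by lia; simpl pred.
  rewrite (tech5 (fun i => _ (S (S j)) (S i) * _)).
  rewrite (sum_eq _ (fun i => Binomial.C (S j) (S i) * v (S i)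
                         + Binomial.C (S j) i * v (S i))).
  2: { intros i hi; rewrite <- (pascal (S j) i) by lia; ring. }
  rewrite sum_plus.
  rewrite (sum_eq (fun i => Binomial.C (S j) i * (v i + v (S i)))
    (fun i => Binomial.C (S j) i * v i + Binomial.C (S j) i * v (S i)))
    by (intros; ring).
  rewrite sum_plus, (tech5 (fun i => _ * v (S i))).
  rewrite (decomp_sum (fun i => Binomial.C (S j) i * v i)) by lia.
  simpl pred.
  rewrite !C_n_0, !C_n_n; ring.
Qed.

Lemma shift_pow_binomial p j u k :
  sum_f_R0 (fun i => Binomial.C j i * p ^ (j - i) * u (k + i)%nat) j
  = shift_pow p j u k.
Proof.
  revert k; induction j as [|j IH]; intros k.
  { simpl; unfold Binomial.C; simpl; rewrite Nat.add_0_r; field. }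
  simpl shift_pow; rewrite <- !IH, scal_sum, <- sum_plus.
  rewrite (sum_eq _ (fun i => Binomial.C (S j) i *
                     (p ^ (S j - i) * u (k + i)%nat))) by (intros; ring).
  rewrite (sum_pascal (fun i => p ^ (S j - i) * u (k + i)%nat)).
  apply sum_eq; intros i hi.
  replace (S j - i)%nat with (S (j - i)) by lia.
  replace (S j - S i)%nat with (j - i)%nat by lia.
  replace (k + S i)%nat with (S k + i)%nat by lia.
  simpl pow; ring.
Qed.

Lemma shift_pow_comb p j u v c k :
  shift_pow p j (fun i => u i + c * v i) k =
  shift_pow p j u k + c * shift_pow p j v k.
Proof.
  revert k; induction j as [|j IH]; intros k; simpl; [reflexivity|].
  rewrite !IH; ring.
Qed.

Lemma shift_pow_zero p j u k :
  (forall i, (i <= j)%nat -> u (k + i)%nat = 0) -> shift_pow p j u k = 0.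
Proof.
  revert k; induction j as [|j IH]; intros k hu; simpl.
  - rewrite <- (Nat.add_0_r k); apply hu; lia.
  - rewrite !IH; [ring| |].
    + intros i hi; apply hu; lia.
    + intros i hi; rewrite Nat.add_succ_comm; apply hu; lia.
Qed.

(** * Uniqueness *)

(** [D] commutes with [(D + p)^j]. *)
Lemma is_derive_on_shift_pow a b n p (dy : nat -> R -> R) j k t :
  a < b -> itv_cc a b t ->
  (forall i, (i < n)%nat -> is_derive_on (itv_cc a b) (dy i) t (dy (S i) t)) ->
  (k + j < n)%nat ->
  is_derive_on (itv_cc a b) (fun s => shift_pow p j (fun i => dy i s) k) t
    (shift_pow p j (fun i => dy i t) (S k)).
Proof.
  intros hab ht hdy; revert k; induction j as [|j IH]; intros k hk; simpl.
  - apply hdy; lia.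
  - apply is_derive_on_comb; trivial; apply IH; lia.
Qed.

Lemma is_derive_on_exp_mult a b (g : R -> R) (t l p : R) :
  a < b -> itv_cc a b t -> is_derive_on (itv_cc a b) g t l ->
  is_derive_on (itv_cc a b) (fun x => exp (p * x) * g x) t
    (exp (p * t) * (l + p * g t)).
Proof.
  intros hab ht H.
  destruct (is_derive_on_extend _ _ _ _ _ hab ht H) as [h [d e]].
  apply (is_derive_on_restrict _ _ (fun x => exp (p * x) * h x)); trivial.
  - auto_derive.
    + now exists l.
    + replace (Derive (fun x : R => h x) t) with l
        by (symmetry; exact (is_derive_unique _ _ _ d)).
      rewrite (e t ht); ring.
  - intros x hx; now rewrite e.
Qed.

(** Descent on [j]: [(D + p)^(j+1) y = 0] says that [exp (p t)] times
    [(D + p)^j y] is constant, and it vanishes at [a] because only derivatives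
    of order less than [n] enter there. *)
Lemma homogeneous_zero a b n p (dy : nat -> R -> R) :
  a < b ->
  (forall k, (k < n)%nat -> forall t, itv_cc a b t ->
     is_derive_on (itv_cc a b) (dy k) t (dy (S k) t)) ->
  (forall k, (k < n)%nat -> dy k a = 0) ->
  (forall t, itv_cc a b t -> shift_pow p n (fun i => dy i t) 0 = 0) ->
  forall t, itv_cc a b t -> dy 0%nat t = 0.
Proof.
  intros hab hdy hinit heq.
  (* [i] counts the factors [D + p] already removed from [(D + p)^n]. *)
  assert (H : forall i j, (i + j = n)%nat -> forall t, itv_cc a b t ->
    shift_pow p j (fun k => dy k t) 0 = 0).
  { induction i as [|i IH]; intros j hij t ht.
    { replace j with n by lia; now apply heq. }
    assert (hz : exp (p * t) * shift_pow p j (fun k => dy k t) 0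
               = exp (p * a) * shift_pow p j (fun k => dy k a) 0).
    { apply (is_derive_on_const a b
        (fun s => exp (p * s) * shift_pow p j (fun k => dy k s) 0));
        trivial.
      intros s hs.
      rewrite <- (Rmult_0_r (exp (p * s))), <- (IH (S j) ltac:(lia) s hs).
      apply is_derive_on_exp_mult; trivial.
      apply (is_derive_on_shift_pow a b n p dy); trivial; [|lia].
      intros k hk; now apply hdy. }
    rewrite (shift_pow_zero p j (fun k => dy k a)), Rmult_0_r in hz
      by (intros; apply hinit; lia).
    apply Rmult_integral in hz; destruct hz as [hz|hz]; trivial.
    generalize (exp_pos (p * t)); lra. }
  intros t ht; exact (H n O (Nat.add_0_r n) t ht).
Qed.

Lemma solves_ivp_unique a b n p r y1 y2 :
  a < b -> solves_ivp a b n p r y1 -> solves_ivp a b n p r y2 ->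
  forall t, itv_cc a b t -> y1 t = y2 t.
Proof.
  intros hab [u [[hu0 hu] [hur hua]]] [v [[hv0 hv] [hvr hva]]] t ht.
  rewrite <- hu0, <- hv0 by assumption.
  apply Rminus_diag_uniq.
  replace (u 0%nat t - v 0%nat t) with (u 0%nat t + -1 * v 0%nat t) by ring.
  apply (homogeneous_zero a b n p (fun k s => u k s + -1 * v k s)); trivial.
  - intros k hk s hs; apply is_derive_on_comb; auto.
  - intros k hk; rewrite hua, hva by assumption; ring.
  - intros s hs; rewrite shift_pow_comb, <- !shift_pow_binomial; cbn [Nat.add].
    rewrite <- (Rplus_opp_r (r s)), <- (hur s hs) at 1.
    rewrite <- (hvr s hs); ring.
Qed.

(** * Iterated integrals *)

Fixpoint iter_int (a : R) (g : R -> R) (j : nat) : R -> R :=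
  match j with
  | O => g
  | S j => fun t => RInt (iter_int a g j) a t
  end.

Lemma iter_int_continuous_derive (a : R) (g : R -> R)
    (hg : forall x, continuous g x) j :
  (forall x, continuous (iter_int a g j) x) /\
  (forall x, is_derive (iter_int a g (S j)) x (iter_int a g j x)).
Proof.
  assert (H : forall j, (forall x, continuous (iter_int a g j) x) ->
    forall x, is_derive (iter_int a g (S j)) x (iter_int a g j x)).
  { intros i hc x; apply is_derive_RInt with (a := a); [|apply hc].
    apply filter_forall; intros y.
    apply (RInt_correct (V := R_CompleteNormedModule)).
    apply (ex_RInt_continuous (V := R_CompleteNormedModule)).
    intros; apply hc. }
  induction j as [|j [IH1 IH2]]; (split; [|apply H]); trivial.
  - intros x; apply (ex_derive_continuous (iter_int a g (S j))).
    eexists; apply IH2.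
  - intros x; apply (ex_derive_continuous (iter_int a g (S j))).
    eexists; apply IH2.
Qed.

Lemma continuous_kernel_mult t i h s :
  continuous h s ->
  continuous (fun s => (t - s) ^ i / INR (fact i) * h s) s.
Proof.
  intros hh; apply (continuous_mult (K := R_AbsRing)); trivial.
  apply (ex_derive_continuous (fun s => (t - s) ^ i / INR (fact i))).
  auto_derive; trivial.
Qed.

(** The boundary terms vanish: the kernel at [s = t], the integral at
    [s = a].  Each use trades a power in the kernel for one more integration. *)
Lemma iter_int_by_parts (a : R) (g : R -> R)
    (hg : forall x, continuous g x) t i j :
  RInt (fun s => (t - s) ^ S i / INR (fact (S i)) * iter_int a g j s) a t =
  RInt (fun s => (t - s) ^ i / INR (fact i) * iter_int a g (S j) s) a t.
Proof.
  destruct (iter_int_continuous_derive a g hg j) as [hc hd].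
  destruct (iter_int_continuous_derive a g hg (S j)) as [hc' _].
  set (U := fun s => (t - s) ^ S i / INR (fact (S i)) * iter_int a g j s).
  set (V := fun s => (t - s) ^ i / INR (fact i) * iter_int a g (S j) s).
  assert (cU : forall s, continuous U s)
    by (intros; now apply continuous_kernel_mult).
  assert (cV : forall s, continuous V s)
    by (intros; now apply continuous_kernel_mult).
  assert (HI : is_RInt (fun s => minus (U s) (V s)) a t 0).
  { set (W := fun s => (t - s) ^ S i / INR (fact (S i)) * iter_int a g (S j) s).
    replace 0 with (minus (W t) (W a)).
    2: { unfold W; simpl iter_int; rewrite RInt_point.
         change (((t - t) ^ S i / INR (fact (S i)) * RInt (iter_int a g j) a t)
           - (t - a) ^ S i / INR (fact (S i)) * 0 = 0).
         simpl pow; unfold Rdiv; ring. }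
    apply (is_RInt_derive (V := R_CompleteNormedModule)).
    - intros s _; unfold W, U, V.
      generalize (hd s); generalize (iter_int a g (S j)); intros I hI.
      auto_derive.
      + now exists (iter_int a g j s).
      + replace (Derive (fun x : R => I x) s) with (iter_int a g j s)
          by (symmetry; exact (is_derive_unique _ _ _ hI)).
        change (match i with O => 1 | S _ => INR i + 1 end) with (INR (S i)).
        change (fact i + i * fact i)%nat with (S i * fact i)%nat.
        change (fact (S i)) with (S i * fact i)%nat; rewrite mult_INR.
        change (@minus _ ?x ?y) with (x - y).
        change (t + - s) with (t - s); cbn [pow]; field.
        split; [apply INR_fact_neq_0|now apply not_0_INR].
    - intros s _; now apply (continuous_minus (V := R_NormedModule)). }
  apply (is_RInt_unique (V := R_CompleteNormedModule)) in HI.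
  rewrite (RInt_minus (V := R_CompleteNormedModule)) in HI
    by (apply (ex_RInt_continuous (V := R_CompleteNormedModule)); trivial).
  now apply Rminus_diag_uniq.
Qed.

(** Cauchy's formula for repeated integration. *)
Lemma iter_int_cauchy (a : R) (g : R -> R)
    (hg : forall x, continuous g x) t m :
  RInt (fun s => (t - s) ^ m / INR (fact m) * g s) a t = iter_int a g (S m) t.
Proof.
  assert (H : forall i j,
    RInt (fun s => (t - s) ^ i / INR (fact i) * iter_int a g j s) a t
    = iter_int a g (S i + j) t).
  { induction i as [|i IH]; intros j.
    - simpl; apply RInt_ext; intros s _; simpl; field.
    - rewrite iter_int_by_parts, IH by assumption; f_equal; lia. }
  rewrite <- (Nat.add_0_r (S m)), <- H; reflexivity.
Qed.

(** * Existence *)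

(** The [j]-fold iterate on [F] of the inverse of [D + p] with zero value at
    [a]. *)
Definition damped_int (a p : R) (F : R -> R) (j : nat) (t : R) : R :=
  exp (- p * t) * iter_int a (fun s => exp (p * s) * F s) j t.

(** For a family with [D (G (j+1)) = G j - p G (j+1)], the operator [D] acts on
    the family as [L - p], where [L] lowers the index; [cascade p G k j] is
    [(L - p)^k G] at index [j], hence the [k]-th derivative of [G j].  It is a
    derivative only for [k <= j], since [D (G 0)] is not given by the family. *)
Fixpoint cascade (p : R) (G : nat -> R -> R) (k j : nat) (t : R) : R :=
  match k with
  | O => G j t
  | S k => cascade p G k (pred j) t - p * cascade p G k j t
  end.

Lemma cascade_derive p (G : nat -> R -> R) :
  (forall j t, is_derive (G (S j)) t (G j t - p * G (S j) t)) ->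
  forall k j t, (k < j)%nat ->
  is_derive (cascade p G k j) t (cascade p G (S k) j t).
Proof.
  intros hG k; induction k as [|k IH]; intros j t hkj.
  - destruct j; [lia|]; apply hG.
  - change (is_derive
      (fun s => cascade p G k (pred j) s - p * cascade p G k j s) t
      (cascade p G (S k) (pred j) t - p * cascade p G (S k) j t)).
    apply (is_derive_minus (V := R_NormedModule)); [apply IH; lia|].
    apply is_derive_scal; apply IH; lia.
Qed.

(** The shift in [k] is multiplication by [L - p], so adding [p] leaves [L]:
    [(D + p)^i] lowers the index by [i]. *)
Lemma cascade_shift_pow p G j i k t :
  shift_pow p i (fun k => cascade p G k j t) k = cascade p G k (j - i) t.
Proof.
  revert k; induction i as [|i IH]; intros k; simpl.
  - now rewrite Nat.sub_0_r.
  - rewrite !IH; simpl; replace (pred (j - i)) with (j - S i)%nat by lia; ring.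
Qed.

Lemma cascade_init p G t :
  (forall j, G (S j) t = 0) ->
  forall k j, (k < j)%nat -> cascade p G k j t = 0.
Proof.
  intros hG k; induction k as [|k IH]; intros j hkj; simpl.
  - destruct j; [lia|apply hG].
  - rewrite !IH by lia; ring.
Qed.

Lemma continuous_exp_weight p (F : R -> R) :
  (forall x, continuous F x) ->
  forall x, continuous (fun s : R => exp (p * s) * F s) x.
Proof.
  intros hF x; apply (continuous_mult (K := R_AbsRing)); trivial.
  apply (ex_derive_continuous (fun s => exp (p * s))); auto_derive; trivial.
Qed.

Lemma damped_int_derive a p F :
  (forall x, continuous F x) -> forall j t,
  is_derive (damped_int a p F (S j)) t
    (damped_int a p F j t - p * damped_int a p F (S j) t).
Proof.
  intros hF j t.
  assert (hg := continuous_exp_weight p F hF).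
  unfold damped_int.
  set (g := fun s : R => exp (p * s) * F s).
  generalize (proj2 (iter_int_continuous_derive a g hg j) t).
  generalize (iter_int a g (S j)); intros I hI.
  auto_derive.
  - eexists; exact hI.
  - replace (Derive (fun x : R => I x) t) with (iter_int a g j t)
      by (symmetry; exact (is_derive_unique _ _ _ hI)).
    ring.
Qed.

Lemma damped_int_solves a b p F n :
  a < b -> (forall x, continuous F x) ->
  solves_ivp a b n p F (damped_int a p F n).
Proof.
  intros hab hF.
  exists (fun k => cascade p (damped_int a p F) k n).
  split; [split; [reflexivity|]|split].
  - intros k hk t ht.
    apply (is_derive_on_restrict _ _ (cascade p (damped_int a p F) k n));
      trivial.
    apply cascade_derive; trivial.
    now apply damped_int_derive.
  - intros t ht.
    transitivity
      (shift_pow p n (fun k => cascade p (damped_int a p F) k n t) 0);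
      [exact (shift_pow_binomial p n _ 0)|].
    rewrite cascade_shift_pow, Nat.sub_diag.
    unfold cascade, damped_int; simpl.
    rewrite <- Rmult_assoc, <- exp_plus.
    replace (- p * t + p * t) with 0 by ring; rewrite exp_0; ring.
  - intros k hk; apply cascade_init; trivial.
    intros j; unfold damped_int; simpl; rewrite RInt_point.
    apply Rmult_0_r.
Qed.

(** The weights combine because [exp (- p t) exp (p s) = exp (- (t - s) p)]. *)
Lemma damped_int_convolution a p F m t :
  (forall x, continuous F x) ->
  damped_int a p F (S m) t =
  RInt (fun s => (t - s) ^ m / INR (fact m) * exp (- (t - s) * p) * F s) a t.
Proof.
  intros hF.
  assert (hg := continuous_exp_weight p F hF).
  unfold damped_int; rewrite <- iter_int_cauchy by assumption.
  rewrite <- (RInt_scal (V := R_CompleteNormedModule)).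
  2: { apply (ex_RInt_continuous (V := R_CompleteNormedModule)).
       intros; now apply continuous_kernel_mult. }
  apply RInt_ext; intros s _.
  change (exp (- p * t) * ((t - s) ^ m / INR (fact m) * (exp (p * s) * F s))
    = (t - s) ^ m / INR (fact m) * exp (- (t - s) * p) * F s).
  replace (- (t - s) * p) with (- p * t + p * s) by ring.
  rewrite exp_plus; ring.
Qed.

Lemma solves_ivp_ext a b n p r1 r2 y1 y2 :
  (forall t, itv_cc a b t -> r1 t = r2 t) ->
  (forall t, itv_cc a b t -> y1 t = y2 t) ->
  solves_ivp a b n p r1 y1 -> solves_ivp a b n p r2 y2.
Proof.
  intros hr hy [dy [[h0 hd] [he hi]]]; exists dy.
  split; [split; trivial|split; trivial].
  - intros t ht; rewrite <- hy; auto.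
  - intros t ht; rewrite <- hr; auto.
Qed.

Theorem theorem2 (a b : R) (hab : a < b)
  (f : R -> R) (hf : continuous_on (itv_cc a b) f)
  (alpha : R) (halpha : 0 < alpha)
  (halphaN : forall m : nat, (1 <= m)%nat -> alpha <> INR m)
  (n : nat) (hn : Z.of_nat n = Zceil alpha)
  (Omega : R -> Prop) (psi : R -> R) (hpsi : admissible Omega psi)
  (w : R) (hw : Omega w) :
  let r := fun t : R =>
    c_coef n alpha * Derive psi w * Rpower (psi w) (INR n - 1 - alpha) *
    INR (fact (n - 1)) * f t in
  solves_ivp a b n (psi w) r (fun t => phi a f n alpha psi t w) /\
  (forall y : R -> R, solves_ivp a b n (psi w) r y ->
     forall t, itv_cc a b t -> y t = phi a f n alpha psi t w).
Proof.
  intros r.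
  assert (hphi : solves_ivp a b n (psi w) r (fun t => phi a f n alpha psi t w)).
  2: { split; trivial; intros y hy; now apply (solves_ivp_unique a b n (psi w) r). }
  assert (hcf := continuous_clamp_ext a b f hab hf).
  destruct n as [|m].
  (* The ceiling of a positive number is not 0. *)
  { assert (hc := proj2 (Zceil_bound alpha)); rewrite <- hn in hc.
    simpl in hc; lra. }
  set (F := fun s => f (clamp a b s)) in hcf.
  set (K := c_coef (S m) alpha * Derive psi w
            * Rpower (psi w) (INR (S m) - 1 - alpha) * INR (fact (S m - 1))) in r.
  assert (hcr : forall x, continuous (fun s => K * F s) x).
  { intros x; apply (continuous_scal_r (V := R_NormedModule)); apply hcf. }
  apply (solves_ivp_ext a b (S m) (psi w) (fun s => K * F s) r
    (damped_int a (psi w) (fun s => K * F s) (S m))).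
  - intros t ht; unfold r, F; now rewrite clamp_id.
  - intros t ht.
    rewrite damped_int_convolution by assumption.
    unfold phi.
    replace (INR (S m) - alpha - 1) with (INR (S m) - 1 - alpha) by ring.
    rewrite Nat.sub_succ, Nat.sub_0_r.
    (* The [(n-1)!] in [K] cancels the one in the kernel of Cauchy's formula. *)
    rewrite (RInt_ext _ (fun s => scal (K / INR (fact m))
      ((t - s) ^ m * exp (- (t - s) * psi w) * F s))).
    2: { intros s _; unfold scal, mult; simpl; unfold mult; simpl.
         field; apply INR_fact_neq_0. }
    rewrite (RInt_scal (V := R_CompleteNormedModule)).
    2: { apply (ex_RInt_continuous (V := R_CompleteNormedModule)).
       intros s _; apply (continuous_mult (K := R_AbsRing)); [|apply hcf].
       apply (ex_derive_continuous (fun s => (t - s) ^ m * exp (- (t - s) * psi w))).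
       auto_derive; trivial. }
    rewrite (RInt_ext _ (fun s => (t - s) ^ m * exp (- (t - s) * psi w) * f s)).
    + change (@scal _ _ ?x ?y) with (x * y); unfold K.
      rewrite Nat.sub_succ, Nat.sub_0_r; field; apply INR_fact_neq_0.
    + intros s hs; unfold F; rewrite clamp_id; trivial.
      unfold itv_cc in *; rewrite Rmin_left, Rmax_right in hs; lra.
  - now apply damped_int_solves.
Qed.
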